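(* Let $(\Omega,\mathcal F,\mu)$ be a finite measure space, $p\in[1,\infty)$ and $k\ge1$. Then $\mathscr G_{p,k}$ is proximinal in $L^p(\Omega,\mathcal F,\mu)$. Moreover, let $f\in L^p$ and let $g=\sum_{i=1}^q b_i\mathbf 1_{A_i}$ be a minimizer ($\|f-g\|_p=\mathscr D_{p,k}(f)$) with $q\le k$, $b_1<\dots<b_q$ real, and $\{A_i\}_{1\le i\le q}$ a measurable partition of $\Omega$ with $\mu(A_i)>0$ for all $i$. Put $r_1=-\infty$, $r_{q+1}=+\infty$, $r_i=\frac{b_{i-1}+b_i}{2}$ for $2\le i\le q$, and $C_i=f^{-1}([r_i,r_{i+1}))$ for $1\le i\le q$. Then $\sum_{i=1}^q b_i\mathbf 1_{C_i}$ is a minimizer; for each $i$ with $\mu(C_i)>0$, $b_i$ is a $p$-th mean of $f$ on $C_i$; and $\tilde g=\sum_{i=1}^q\mathcal M_p(f,C_i)\mathbf 1_{C_i}$ is also a minimizer in $\mathscr G_{p,q}$. If $q$ is the smallest number of distinct values among all minimizers, then $\mu(C_i)>0$ for all $i$.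
   Context: $\mathscr G_{p,k}$ is the set of functions $\sum_{i=1}^l a_i\mathbf 1_{A_i}\in L^p$ with $l\le k$, $\{A_i\}$ a measurable partition of $\Omega$, $a_i\in\mathbb R$; $\mathscr D_{p,k}(f)=\inf\{\|f-h\|_p:\ h\in\mathscr G_{p,k}\}$; a minimizer is any $g\in\mathscr G_{p,k}$ with $\|f-g\|_p=\mathscr D_{p,k}(f)$; $\mathscr G_{p,k}$ is proximinal if minimizers exist for every $f\in L^p$. $p$-th mean: for measurable $A$ with $0<\mu(A)<\infty$, a $p$-th mean of $f$ on $A$ is any minimizer over $a\in\mathbb R$ of $\int_A|f-a|^p\,d\mu$; for $p>1$ it is unique and denoted $\mathcal M_p(f,A)$; for $p=1$ the minimizers form a bounded closed interval $[a^*,b^*]$ and $\mathcal M_1(f,A)=(a^*+b^* )/2$; if $\mu(A)=0$, $\mathcal M_p(f,A)=0$. *)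

(* Defs.v *)
From HB Require Import structures.
From mathcomp Require Import all_boot all_order all_algebra.
From mathcomp Require Import all_classical all_reals all_analysis.
Set Implicit Arguments. Unset Strict Implicit. Unset Printing Implicit Defensive.
Import Order.TTheory GRing.Theory Num.Theory.
Local Open Scope classical_set_scope.
Local Open Scope ring_scope.

(* Families are indexed by nat, only the indices i < l matter. *)

(* {A_0,...,A_{l-1}} is a measurable partition of the whole space T
   (empty blocks are allowed). *)
Definition meas_partition d (T : measurableType d) (l : nat) (A : nat -> set T) :=
  [/\ (forall i, (i < l)%N -> measurable (A i)),
      (forall i j, (i < l)%N -> (j < l)%N -> i != j -> A i `&` A j = set0) &
      (forall x, exists2 i, (i < l)%N & A i x)].

Definition stepfun d (T : measurableType d) (R : realType) (l : nat)
  (a : nat -> R) (A : nat -> set T) : T -> R :=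
  fun x => \sum_(i < l) a i * \1_(A i) x.

Definition in_Lp d (T : measurableType d) (R : realType)
  (mu : {measure set T -> \bar R}) (p : R) (f : T -> R) :=
  measurable_fun setT f /\ (Lnorm mu p%:E (EFin \o f) < +oo)%E.

Definition Gpk d (T : measurableType d) (R : realType)
  (mu : {measure set T -> \bar R}) (p : R) (k : nat) (h : T -> R) :=
  in_Lp mu p h /\
  exists l (a : nat -> R) (A : nat -> set T),
    [/\ (l <= k)%N, meas_partition l A & h = stepfun l a A].

Definition Dpk d (T : measurableType d) (R : realType)
  (mu : {measure set T -> \bar R}) (p : R) (k : nat) (f : T -> R) : \bar R :=
  ereal_inf [set Lnorm mu p%:E (EFin \o (f \- h)) | h in Gpk mu p k].

Definition is_minimizer d (T : measurableType d) (R : realType)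
  (mu : {measure set T -> \bar R}) (p : R) (k : nat) (f g : T -> R) :=
  Gpk mu p k g /\ Lnorm mu p%:E (EFin \o (f \- g)) = Dpk mu p k f.

Definition proximinal d (T : measurableType d) (R : realType)
  (mu : {measure set T -> \bar R}) (p : R) (k : nat) :=
  forall f, in_Lp mu p f -> exists g, is_minimizer mu p k f g.

Definition is_pmean d (T : measurableType d) (R : realType)
  (mu : {measure set T -> \bar R}) (p : R) (f : T -> R) (A : set T) (a : R) :=
  forall b : R, (\int[mu]_(x in A) (`|f x - a| `^ p)%:E
                 <= \int[mu]_(x in A) (`|f x - b| `^ p)%:E)%E.

(* \mathcal M_p(f,A): 0 if mu A = 0; the (unique) p-th mean if p > 1;
   the midpoint of the interval of p-th means if p = 1. *)
Definition Mp d (T : measurableType d) (R : realType)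
  (mu : {measure set T -> \bar R}) (p : R) (f : T -> R) (A : set T) : R :=
  if mu A == 0%E then 0
  else if 1 < p then xget 0 (is_pmean mu p f A)
  else (inf (is_pmean mu p f A) + sup (is_pmean mu p f A)) / 2.

(* C_i = f^{-1}([r_i, r_{i+1})), 0-based: i = 0 .. q-1, with
   r_0 = -oo, r_q = +oo, r_i = (b_{i-1} + b_i)/2 otherwise *)
Definition Cset d (T : measurableType d) (R : realType)
  (q : nat) (b : nat -> R) (f : T -> R) (i : nat) : set T :=
  [set x | ((i == 0)%N || ((b i.-1 + b i) / 2 <= f x)) &&
           ((i.+1 == q)%N || (f x < (b i + b i.+1) / 2))].

(* Main.v *)
(** Sending each point x to the value b_i closest to f x never increases the
    cost |f x - b_i|, and the sets C_i realise this choice; on a fixed partition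
    the p-th power of the error is the sum of its contributions over the blocks,
    so that each b_i must be optimal on C_i and can be exchanged for any other
    p-th mean, while the value on a null block is irrelevant.

    For proximinality, pass to a subsequence of a minimising sequence along
    which each of the k values converges or escapes to infinity. By Fatou's
    lemma the distance of f to the set of finite limits is at least as good as
    the infimum; if all the values escaped, the limit cost would be infinite
    unless mu = 0. *)

Require Import Defs.
From HB Require Import structures.
From mathcomp Require Import all_boot all_order all_algebra.
From mathcomp Require Import all_classical all_reals all_analysis.
From mathcomp Require Import measurable_realfun lra.
Import Order.TTheory GRing.Theory Num.Theory numFieldNormedType.Exports.
Local Open Scope classical_set_scope.
Local Open Scope ring_scope.

(** * Bounds for lower limits and powers *)

Lemma limn_einf_ge (R : realType) (u : (\bar R)^nat) (c : \bar R) :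
  (\forall n \near \oo, (c <= u n)%E) -> (c <= limn_einf u)%E.
Proof.
move=> [N _ cu]; rewrite limn_einf_lim; apply: lime_ge; first exact: is_cvg_einfs.
exists N => // n /= Nn; apply: le_ereal_inf_tmp => _ [m /= nm <-].
by apply: cu; exact: leq_trans nm.
Qed.

Lemma limn_einf_le (R : realType) (u : (\bar R)^nat) (c : \bar R) :
  (\forall n \near \oo, (u n <= c)%E) -> (limn_einf u <= c)%E.
Proof.
move=> [N _ uc]; rewrite limn_einf_lim; apply: lime_le; first exact: is_cvg_einfs.
apply: nearW => n; apply: (@le_trans _ _ (u (maxn n N))).
  by apply: ereal_inf_lbound; exists (maxn n N) => //=; rewrite leq_maxl.
by apply: uc => /=; rewrite leq_maxr.
Qed.

(** Left continuity of the p-th power at [m]: if a real [L] were smaller than the power of [m], the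
    midpoint between the p-th root of [L] and [m] would violate the assumption. *)
Lemma powR_le_of_lt (R : realType) (p m : R) (L : \bar R) :
  0 < p -> 0 <= m -> (0 <= L)%E ->
  (forall y, 0 <= y -> y < m -> ((y `^ p)%:E <= L)%E) -> ((m `^ p)%:E <= L)%E.
Proof.
move=> p0 m0; case: L => [r||//]; last by move=> *; rewrite leey.
rewrite lee_fin => r0 yL; rewrite lee_fin leNgt; apply/negP => rm.
have pV : p != 0 by rewrite gt_eqF.
have s0 : 0 <= r `^ p^-1 by rewrite powR_ge0.
have sr : (r `^ p^-1) `^ p = r by rewrite -powRrM mulVf// powRr1.
have sm : r `^ p^-1 < m.
  rewrite ltNge; apply/negP => ms; move: rm; rewrite -[X in X < _]sr ltNge.
  by rewrite (ge0_ler_powR (ltW p0)) ?nnegrE.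
set s := r `^ p^-1 in s0 sr sm *.
have y0 : 0 <= (s + m) / 2 by lra.
have ym : (s + m) / 2 < m by lra.
have := yL _ y0 ym; rewrite lee_fin -[X in _ <= X]sr leNgt.
by rewrite gt0_ltr_powR ?nnegrE//; lra.
Qed.

(** * Step functions and the partition into nearest-value cells *)

Section partitions.
Context {d : measure_display} {T : measurableType d} {R : realType}.

Lemma stepfunE (l : nat) (a : nat -> R) (A : nat -> set T) (i : nat) (x : T) :
  meas_partition l A -> (i < l)%N -> A i x -> stepfun l a A x = a i.
Proof.
move=> [_ disj _] il Aix.
rewrite /stepfun (bigD1 (Ordinal il))//= big1 ?addr0.
  by rewrite indicE mem_set// mulr1.
move=> j /eqP ji; rewrite indicE memNset ?mulr0// => Ajx.
have ij : i != j by apply/eqP => ij; apply: ji; exact/val_inj.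
by have : (A i `&` A j) x by []; rewrite (disj _ _ il (ltn_ord j) ij).
Qed.

Lemma measurable_stepfun (l : nat) (a : nat -> R) (A : nat -> set T) :
  meas_partition l A -> measurable_fun setT (stepfun l a A).
Proof.
move=> [mA _ _]; rewrite /stepfun.
rewrite (_ : (fun x => _) =
    (fun x => \sum_(i <- index_enum 'I_l) a i * \1_(A i) x)); last by [].
apply: measurable_sum => i.
by apply: measurable_funM => //; apply: measurable_indic; apply: mA.
Qed.

Section Cset.
Variables (q : nat) (b : nat -> R) (f : T -> R).
Hypothesis b_incr : forall i j, (i < j)%N -> (j < q)%N -> b i < b j.

Let b_le (i j : nat) : (i <= j)%N -> (j < q)%N -> b i <= b j.
Proof.
by rewrite leq_eqVlt => /orP[/eqP->//|ij jq]; apply: ltW; exact: b_incr.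
Qed.

(** Membership in the cell only compares [f x] with the midpoints adjacent to [b i]; monotonicity of
    [b] carries the comparison over to all values further away. *)
Lemma Cset_nearest (i j : nat) (x : T) : (i < q)%N -> (j < q)%N ->
  Cset q b f i x -> `|f x - b i| <= `|f x - b j|.
Proof.
move=> iq jq /andP[lo hi]; have [ij|ji|->//] := ltngtP i j.
- move: hi; rewrite (_ : (i.+1 == q) = false) /=; last first.
    by apply/negbTE; rewrite neq_ltn (leq_ltn_trans ij).
  move=> hi; have h1 := b_le _ _ ij jq; have h2 := b_le _ _ (ltnW ij) jq.
  have : f x - b j <= 0 by have := b_le _ _ (leqnSn i) (leq_ltn_trans ij jq); lra.
  by move=> h3; rewrite (ler0_norm h3) ler_norml; apply/andP; split; lra.
- case: i iq lo ji hi => [//|i] iq /= lo ji _.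
  have h1 := b_le _ _ (ji : (j <= i)%N) (ltnW iq); have h2 := b_le _ _ (ltnW ji) iq.
  have h3 : 0 <= f x - b j by have := b_le _ _ (leqnSn i) iq; lra.
  by rewrite (ger0_norm h3) ler_norml; apply/andP; split; lra.
Qed.

(** An empty [T] is compatible with [q = 0], so positivity of [q] is asked for only in the presence
    of a point. *)
Lemma Cset_partition : measurable_fun setT f -> (T -> (0 < q)%N) ->
  meas_partition q (Cset q b f).
Proof.
move=> mf q0; split.
- move=> i _; rewrite /Cset.
  have mT (r : interval R) (c : bool) : measurable [set x | c || (f x \in r)].
    case: c => /=; first by rewrite (_ : [set _ | _] = setT) //; apply/seteqP; split.
    by rewrite -[X in measurable X]setTI; exact: (mf measurableT [set` r]).
  have := measurableI _ _ (mT `[(b i.-1 + b i) / 2, +oo[ (i == 0)%N)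
                          (mT `]-oo, (b i + b i.+1) / 2[ (i.+1 == q)%N).
  congr measurable; apply/seteqP; split => x /=; rewrite !in_itv/= ?andbT.
    by case=> -> ->.
  by case/andP.
- suff main i j x : (i < j)%N -> (j < q)%N -> Cset q b f i x -> Cset q b f j x -> False.
    move=> i j iq jq ij; apply/seteqP; split => x //= -[Cix Cjx].
    by move: ij; rewrite neq_ltn => /orP[ij|ji]; [apply: (main i j x)|apply: (main j i x)].
  move=> ij jq /andP[_ hi] /andP[lo _].
  move: hi; rewrite (_ : (i.+1 == q) = false) /=; last first.
    by apply/negbTE; rewrite neq_ltn (leq_ltn_trans ij).
  case: j ij jq lo => [//|j] ij jq /= lo hi.
  have h1 := b_le _ _ (ij : (i <= j)%N) (ltnW jq).
  have h2 := b_le _ _ (ij : (i.+1 <= j.+1)%N) jq.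
  by clear -lo hi h1 h2; lra.
- move=> x.
  (* The cell of [x] is the first one whose right endpoint exceeds [f x]. The last index always
     qualifies, and minimality gives the inequality at the left endpoint. *)
  have ex : exists i, (i.+1 == q) || (f x < (b i + b i.+1) / 2).
    by exists q.-1; rewrite prednK ?eqxx// (q0 x).
  case: (ex_minnP ex) => i Pi mini; exists i.
    by rewrite -[X in (_ < X)%N](prednK (q0 x)) ltnS mini// prednK ?eqxx// (q0 x).
  rewrite /Cset /= Pi andbT; case: i Pi mini => [//|i] Pi mini /=.
  rewrite leNgt; apply/negP => fx.
  by have := mini i; rewrite fx orbT ltnn => /(_ isT).
Qed.

End Cset.
End partitions.

(** * The p-th power of the error *)

Section pcost.
Context {d : measure_display} {T : measurableType d} {R : realType}.

(** Without the p-th root the error is additive over blocks, and for constant [h] it is exactly the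
    integral minimised by a p-th mean. *)
Definition pcost (mu : {measure set T -> \bar R}) (p : R) (D : set T)
    (f h : T -> R) : \bar R :=
  \int[mu]_(x in D) (`|f x - h x| `^ p)%:E.

Section measure.
Variables (mu : {measure set T -> \bar R}) (p : R).
Hypothesis p1 : 1 <= p.

Let p_gt0 : 0 < p. Proof. exact: lt_le_trans p1. Qed.

Let p_neq0 : p != 0. Proof. by rewrite gt_eqF. Qed.

Lemma measurable_pcost (D : set T) (f h : T -> R) :
  measurable_fun setT f -> measurable_fun setT h ->
  measurable_fun D (fun x => (`|f x - h x| `^ p)%:E).
Proof.
move=> mf mh; apply/measurable_EFinP/(measurable_funS measurableT) => //.
apply: (@measurableT_comp _ _ _ _ _ _ (@powR R ^~ p)).
  exact: measurable_powR.
by apply: measurableT_comp => //; exact: measurable_funB.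
Qed.

Lemma pcost_ge0 (D : set T) (f h : T -> R) : (0 <= pcost mu p D f h)%E.
Proof. by apply: integral_ge0 => x _; rewrite lee_fin powR_ge0. Qed.

Lemma Lnorm_pcost (f h : T -> R) :
  (Lnorm mu p%:E (EFin \o (f \- h)%R) `^ p)%E = pcost mu p setT f h.
Proof. by rewrite poweR_Lnorm. Qed.

(** Raising to the powers [p] and [1/p] is monotone on the extended half-line; each gives one
    implication. *)
Lemma le_Lnorm_pcost (f g h : T -> R) :
  (Lnorm mu p%:E (EFin \o (f \- g)%R) <= Lnorm mu p%:E (EFin \o (f \- h)%R))%E =
  (pcost mu p setT f g <= pcost mu p setT f h)%E.
Proof.
have ge0y (u : T -> \bar R) : Lnorm mu p%:E u \in `[0%E, +oo%E].
  by rewrite in_itv/= Lnorm_ge0 leey.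
apply/idP/idP => [gh|]; first by rewrite -!Lnorm_pcost gt0_ler_poweR// ltW.
rewrite -!Lnorm_pcost => gh.
have pV0 : 0 <= p^-1 by rewrite invr_ge0 ltW.
have p0y (u : \bar R) : (u `^ p)%E \in `[0%E, +oo%E].
  by rewrite in_itv/= poweR_ge0 leey.
have := gt0_ler_poweR pV0 (p0y _) (p0y _) gh.
by rewrite -!poweRrM mulfV// !poweRe1// Lnorm_ge0.
Qed.

(** Trades the infimum of norms for direct comparisons of costs, the form in which minimality is
    used from here on. *)
Lemma is_minimizerP (k : nat) (f g : T -> R) :
  is_minimizer mu p k f g <-> Gpk mu p k g /\
    forall h, Gpk mu p k h -> (pcost mu p setT f g <= pcost mu p setT f h)%E.
Proof.
split=> -[Gg].
  move=> gD; split=> [|h Gh]; first exact: Gg.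
  rewrite -le_Lnorm_pcost gD.
  by apply: ereal_inf_lbound; exists h.
move=> gmin; split; first exact: Gg.
apply/eqP; rewrite eq_le; apply/andP; split.
  by apply: le_ereal_inf_tmp => _ [h Gh <-]; rewrite le_Lnorm_pcost; exact: gmin.
by apply: ereal_inf_lbound; exists g.
Qed.

Lemma pcost0_lty (f : T -> R) : in_Lp mu p f ->
  (pcost mu p setT f (cst 0%R) < +oo)%E.
Proof.
move=> [_ foo]; rewrite -Lnorm_pcost.
rewrite (_ : f \- cst 0 = f); last by apply/funext => x /=; rewrite subr0.
exact: poweR_lty.
Qed.

Lemma pcost_stepfun (f : T -> R) (l : nat) (a : nat -> R) (A : nat -> set T) :
  measurable_fun setT f -> meas_partition l A ->
  pcost mu p setT f (stepfun l a A) =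
  (\sum_(i < l) pcost mu p (A i) f (cst (a i)))%E.
Proof.
move=> mf pA; have [mA disj cov] := pA.
(* Sets of index at least [l] are arbitrary; replacing them by the empty set makes the whole family
   measurable and disjoint. *)
pose F i := if (i < l)%N then A i else set0.
have FE i : (i < l)%N -> F i = A i by rewrite /F => ->.
have TE : setT = \big[setU/set0]_(i <- index_iota 0 l) F i.
  rewrite big_mkord -bigcup_mkord; apply/seteqP; split => // x _.
  by have [i il Aix] := cov x; exists i => //; rewrite FE.
rewrite /pcost [in LHS]TE ge0_integral_bigsetU//.
- rewrite big_mkord; apply: eq_bigr => i _; rewrite (FE _ (ltn_ord i)).
  apply: eq_integral => x /[!inE] Aix.
  by rewrite (stepfunE _ _ _ _ _ pA _ Aix).
- by move=> i; rewrite /F; case: ifPn => // il; exact: mA.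
- exact: iota_uniq.
- apply/trivIsetP => i j _ _ ij; rewrite /F.
  case: ifPn => [il|_]; last by rewrite set0I.
  by case: ifPn => [jl|_]; [exact: disj|rewrite setI0].
- by apply: measurable_pcost => //; exact: measurable_stepfun.
Qed.

Lemma pcost_null (D : set T) (f h : T -> R) : measurable D ->
  measurable_fun setT f -> measurable_fun setT h ->
  mu D = 0%E -> pcost mu p D f h = 0%E.
Proof.
move=> mD mf mh D0; apply: null_set_integral => //; exact: measurable_pcost.
Qed.

End measure.

Section finite_measure.
Variables (mu : {finite_measure set T -> \bar R}) (p : R).
Hypothesis p1 : 1 <= p.

Let p_ge0 : 0 <= p. Proof. exact: le_trans p1. Qed.

(** Membership in Lp comes for free: the function is bounded by the sum of the absolute values of
    the coefficients, and [mu] is finite. *)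
Lemma Gpk_stepfun (k l : nat) (a : nat -> R) (A : nat -> set T) :
  (l <= k)%N -> meas_partition l A -> Gpk mu p k (stepfun l a A).
Proof.
move=> lk pA; split; last by exists l, a, A.
split; first exact: measurable_stepfun.
pose M := \sum_(i < l) `|a i|.
have aM x : `|stepfun l a A x| <= M.
  have [_ _ /(_ x)[i il Aix]] := pA; rewrite (stepfunE _ _ _ _ _ pA il Aix).
  by rewrite /M (bigD1 (Ordinal il))//= lerDl sumr_ge0.
rewrite unlock; apply: poweR_lty.
apply: (@le_lt_trans _ _ (\int[mu]_(x in setT) (cst (M `^ p)%:E x))%E).
  apply: ge0_le_integral => //=.
  - have -> : (fun x => (`|stepfun l a A x| `^ p)%:E) =
        (fun x => (`|stepfun l a A x - cst 0 x| `^ p)%:E).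
      by apply/funext => x; rewrite subr0.
    by apply: measurable_pcost => //; exact: measurable_stepfun.
  - move=> x _; rewrite lee_fin ge0_ler_powR ?nnegrE//.
    exact: le_trans (aM x).
rewrite integral_cst//; apply: lte_mul_pinfty => //.
  by rewrite lee_fin powR_ge0.
by rewrite ltey_eq fin_num_measure.
Qed.

Lemma Gpk_cst (k : nat) (c : R) : (0 < k)%N -> Gpk mu p k (cst c).
Proof.
move=> k0.
have pT : meas_partition 1 (fun=> [set: T]).
  by split=> // [[|i] [|j]//|x]; exists 0%N.
have := Gpk_stepfun k 1 (fun=> c) _ k0 pT.
congr Gpk; apply/funext => x; exact: (stepfunE _ _ _ 0%N _ pT).
Qed.

(** The zero function is a competitor of finite cost. *)
Lemma minimizer_lty (k : nat) (f g : T -> R) : (0 < k)%N -> in_Lp mu p f ->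
  is_minimizer mu p k f g -> (pcost mu p setT f g < +oo)%E.
Proof.
move=> k0 fLp /(is_minimizerP _ _ p1)[_ gmin].
exact: le_lt_trans (gmin _ (Gpk_cst k 0 k0)) (pcost0_lty _ _ p1 _ fLp).
Qed.

End finite_measure.
End pcost.

(** * Means on a set, and the midpoint convention for p = 1 *)

Section pmean.
Context {d : measure_display} {T : measurableType d} {R : realType}.
Variables (mu : {finite_measure set T -> \bar R}) (f : T -> R) (A : set T).
Hypotheses (mf : measurable_fun setT f) (mA : measurable A).

(** Convexity of the integral of |f - a| as a function of [a]: its set of minimizers is convex. *)
Lemma is_pmean_between (a1 a2 c : R) : a1 <= c <= a2 ->
  is_pmean mu 1 f A a1 -> is_pmean mu 1 f A a2 -> is_pmean mu 1 f A c.
Proof.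
move=> /andP[a1c ca2] m1 m2 b.
have [a12|a12] := eqVneq a1 a2.
  have -> : c = a1 by apply/eqP; rewrite eq_le a1c a12 ca2.
  exact: m1.
have a12_gt0 : 0 < a2 - a1.
  by rewrite subr_gt0 lt_neqAle a12 (le_trans a1c).
(* The weight for which [c] is the convex combination of [a1] and [a2]. *)
pose t := (a2 - c) / (a2 - a1).
have t0 : 0 <= t by rewrite divr_ge0 ?subr_ge0// (le_trans a1c).
have t1 : 0 <= 1 - t by rewrite subr_ge0 ler_pdivrMr// mul1r lerD2l lerN2.
have cE : c = t * a1 + (1 - t) * a2.
  have : t * (a2 - a1) = a2 - c by rewrite /t divfK// gt_eqF.
  by lra.
have mcost a := measurable_pcost 1 A f (cst a) mf (measurable_cst _).
have cost12 : pcost mu 1 A f (cst a2) = pcost mu 1 A f (cst a1).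
  by apply/eqP; rewrite eq_le; apply/andP; split; [exact: m2|exact: m1].
apply: (@le_trans _ _ (t%:E * pcost mu 1 A f (cst a1) +
                       (1 - t)%:E * pcost mu 1 A f (cst a2))%E); last first.
  rewrite cost12 -ge0_muleDl ?lee_fin; [|exact: t0|exact: t1].
  by rewrite -EFinD addrC subrK mul1e; exact: m1.
have Zcost s a : 0 <= s -> (s%:E * pcost mu 1 A f (cst a) =
    \int[mu]_(x in A) (s%:E * (`|f x - a| `^ 1)%:E))%E.
  move=> s0; apply/esym; apply: ge0_integralZl.
  - exact: mA.
  - exact: (mcost a).
  - by move=> x _; rewrite lee_fin powR_ge0.
  - by rewrite lee_fin.
have mZ s a : measurable_fun A (fun x => s%:E * (`|f x - a| `^ 1)%:E)%E.
  by apply: measurable_funeM; exact: (mcost a).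
have Z0 s a x : 0 <= s -> (0 <= s%:E * (`|f x - a| `^ 1)%:E)%E.
  by move=> s0; rewrite mule_ge0 ?lee_fin ?powR_ge0.
rewrite (Zcost _ a1 t0) (Zcost _ a2 t1) -ge0_integralD; last first.
- exact: mZ.
- by move=> x _; exact: Z0.
- exact: mZ.
- by move=> x _; exact: Z0.
- exact: mA.
apply: ge0_le_integral; first exact: mA.
- by move=> x _; rewrite lee_fin powR_ge0.
- exact: (mcost c).
- by apply: emeasurable_funD; exact: mZ.
move=> x _; rewrite -!EFinM -EFinD lee_fin !powRr1 ?normr_ge0 //=.
rewrite -[X in X * _ + _](ger0_norm t0) -[X in _ + X * _](ger0_norm t1).
rewrite -!normrM; apply: le_trans (ler_normD _ _).
by rewrite {1}cE le_eqVlt; apply/orP; left; apply/eqP; congr `|_|; lra.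
Qed.

Lemma is_pmean_bounded : mu A != 0%E -> in_Lp mu 1 f ->
  exists M : R, forall a, is_pmean mu 1 f A a -> `|a| <= M.
Proof.
move=> A0 fLp.
have mcost a := measurable_pcost 1 A f (cst a) mf (measurable_cst _).
have Ifin : pcost mu 1 A f (cst 0) \is a fin_num.
  rewrite ge0_fin_numE ?pcost_ge0//.
  apply: le_lt_trans (pcost0_lty _ _ (lexx 1) _ fLp).
  apply: ge0_subset_integral; [exact: mA|exact: measurableT|..|exact: subsetT].
    exact: measurable_pcost.
  by move=> x _; rewrite lee_fin powR_ge0.
have muAfin : mu A \is a fin_num by exact: fin_num_measure.
have muA_gt0 : 0 < fine (mu A).
  by rewrite fine_gt0// lt0e A0 measure_ge0 /= ltey_eq muAfin.
(* Integrate |a| <= |f - a| + |f| over [A]; a mean [a] does at least as well as 0, so both terms are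
   at most the integral of |f|. *)
exists (2 * fine (pcost mu 1 A f (cst 0)) / fine (mu A)) => a ma.
rewrite ler_pdivlMr// -lee_fin !EFinM !fineK// -integral_cst//.
apply: (@le_trans _ _ (\int[mu]_(x in A)
    ((`|f x - cst a x| `^ 1)%:E + (`|f x - cst 0 x| `^ 1)%:E))%E).
  apply: ge0_le_integral; first exact: mA.
  - by move=> x _; rewrite lee_fin normr_ge0.
  - exact: measurable_cst.
  - by apply: emeasurable_funD; exact: mcost.
  - move=> x _; rewrite -EFinD lee_fin !powRr1//= subr0.
    by rewrite distrC -[X in `|X| <= _](subrK (f x)) ler_normD.
rewrite ge0_integralD; last first.
- exact: mcost.
- by move=> x _; rewrite lee_fin powR_ge0.
- exact: mcost.
- by move=> x _; rewrite lee_fin powR_ge0.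
- exact: mA.
rewrite (_ : 2%:E = (1 + 1)%:E)%E // EFinD muleDl ?mul1e; [|exact: Ifin|by []].
by apply: leeD; [exact: ma|exact: lexx].
Qed.

Lemma is_pmean_Mp (p a : R) : 1 <= p -> mu A != 0%E -> in_Lp mu p f ->
  is_pmean mu p f A a -> is_pmean mu p f A (Mp mu p f A).
Proof.
move=> p1 A0 fLp ma; rewrite /Mp (negbTE A0).
case: ltP => [_|ple1]; first by apply: xgetPex; exists a.
have pE : p = 1 by apply/eqP; rewrite eq_le ple1.
rewrite {}pE in fLp ma *.
have [M Mbnd] := is_pmean_bounded A0 fLp.
set S := is_pmean mu 1 f A.
have Slb : has_lbound S by exists (- M) => b /Mbnd; rewrite ler_norml => /andP[].
have Sub : has_ubound S by exists M => b /Mbnd; rewrite ler_norml => /andP[].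
have Sa : inf S <= a by exact: ge_inf.
have aS : a <= sup S by exact: ub_le_sup.
have [IS|IS] := eqVneq (inf S) (sup S).
  have -> : (inf S + sup S) / 2 = a by lra.
  exact: ma.
(* Means closer than half the length to either end of the interval enclose its midpoint, which is
   then a mean by convexity. *)
have e0 : 0 < (sup S - inf S) / 2.
  have : inf S < sup S by rewrite lt_neqAle IS (le_trans Sa).
  by lra.
have [a1 Sa1 a1_lt] := inf_adherent e0 (conj (ex_intro _ a ma) Slb).
have [a2 Sa2 a2_gt] := sup_adherent e0 (conj (ex_intro _ a ma) Sub).
apply: (is_pmean_between a1 a2); [apply/andP; split|exact: Sa1|exact: Sa2].
  by lra.
by lra.
Qed.

End pmean.

(* Ultrafilter compactness replaces the extraction of k successive
   subsequences: the coordinates indexed by S converge along phi, the other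
   ones escape to infinity. *)
Lemma cvg_or_escape_subsequence (R : realType) (k : nat) (a : nat -> nat -> R) :
  exists (S : pred nat) (c : nat -> R) (phi : nat -> nat), forall m,
    (m <= phi m)%N /\ forall i, (i < k)%N ->
      if S i then `|a (phi m) i - c i| < m.+1%:R^-1 else m%:R < `|a (phi m) i|.
Proof.
have [U [Uultra ooU]] := @ultraFilterLemma _ \oo _.
have Uproper := @ultra_proper _ _ Uultra.
have dich i : exists sc : bool * R,
    if sc.1 then forall e, 0 < e -> U [set n | `|a n i - sc.2| < e]
    else forall M : R, U [set n | M < `|a n i|].
  have [esc|/existsNP[M nM]] := pselect (forall M : R, U [set n | M < `|a n i|]).
    by exists (false, 0).
  (* Without escape, the ultrafilter contains the complementary set, so the coordinate stays in the
     compact interval [-M, M] and has a cluster point there. *)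
  have [//|bd] := in_ultra_setVsetC [set n | M < `|a n i|] Uultra.
  pose V : set_system R := (fun n => a n i) @ U.
  have VM : V `[- M, M]%classic.
    apply: (@filterS _ U _ _ _ _ bd) => n /= nM'.
    by rewrite in_itv /= -ler_norml leNgt; apply/negP.
  have [c [_ cV]] := @segment_compact R (- M) M V _ VM.
  exists (true, c) => e e0 /=.
  (* For an ultrafilter a cluster point is a limit: otherwise the points at distance at least [e]
     would form a large set, which has to meet the ball. *)
  have [//|far] := in_ultra_setVsetC [set n | `|a n i - c| < e] Uultra.
  have Vfar : V [set x | e <= `|x - c|].
    by apply: (@filterS _ U _ _ _ _ far) => n /= far_n; rewrite leNgt; apply/negP.
  have [x [/= ex]] := cV _ _ Vfar (nbhsx_ballx (c : R) e e0).
  by rewrite /ball /= distrC ltNge ex.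
have [sc scP] := choice dich.
have ex m : exists n, (m <= n)%N /\ forall i : 'I_k,
    if (sc i).1 then `|a n i - (sc i).2| < m.+1%:R^-1 else m%:R < `|a n i|.
  (* Finitely many large sets have a large, hence nonempty, intersection. *)
  suff /filter_ex[n [mn nP]] : U [set n | (m <= n)%N /\ forall i : 'I_k,
    if (sc i).1 then `|a n i - (sc i).2| < m.+1%:R^-1 else m%:R < `|a n i|].
    by exists n.
  apply: filterI; first by apply: ooU; exact: nbhs_infty_ge.
  apply: filter_forall => i; have := scP i; case: ifP => _; last exact.
  by apply; rewrite invr_gt0 ltr0n.
have [phi phiP] := choice ex.
exists (fun i => (sc i).1), (fun i => (sc i).2), phi => m.
have [mphi P] := phiP m; split=> // i ik; exact: (P (Ordinal ik)).
Qed.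

(** * Existence of minimizers *)

Section proximinal.
Context {d : measure_display} {T : measurableType d} {R : realType}.
Variables (mu : {finite_measure set T -> \bar R}) (p : R).
Hypothesis p1 : 1 <= p.

Let p_gt0 : 0 < p. Proof. exact: lt_le_trans p1. Qed.

(** Each of the finitely many coordinates eventually stays at distance at least [y] from [v]: a
    convergent one because its limit is strictly further away, an escaping one because it exceeds y
    + |v|. *)
Lemma limn_einf_nearest_ge (k : nat) (S : pred nat) (c : nat -> R)
    (a : nat -> nat -> R) (v : R) (u : nat -> R) (y : R) :
  (forall m i, (i < k)%N ->
    if S i then `|a m i - c i| < m.+1%:R^-1 else m%:R < `|a m i|) ->
  (forall m, exists2 i, (i < k)%N & u m = a m i) ->
  0 <= y -> (forall i, (i < k)%N -> S i -> y < `|v - c i|) ->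
  ((y `^ p)%:E <= limn_einf (fun m => (`|v - u m| `^ p)%:E))%E.
Proof.
move=> aP ua y0 yc; apply: limn_einf_ge.
have near_i (i : 'I_k) : \forall m \near \oo, y <= `|v - a m i|.
  have [Si|Si] := boolP (S i).
    have := yc i (ltn_ord i) Si; set D := `|v - c i| => yD.
    have : \forall m \near \oo, m.+1%:R^-1 < D - y.
      by apply: near_infty_natSinv_lt (PosNum _); rewrite subr_gt0.
    apply: filterS => m; have := aP m i (ltn_ord i); rewrite Si.
    move: (m.+1%:R^-1) => e am eD.
    have : D <= `|v - a m i| + `|a m i - c i|.
      exact: ler_distD.
    by move=> ?; lra.
  have : \forall m \near \oo, y + `|v| <= m%:R.
    exact: nbhs_infty_ger.
  apply: filterS => m my; have := aP m i (ltn_ord i); rewrite (negbTE Si) => am.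
  have : `|a m i| <= `|v| + `|v - a m i|.
    by rewrite -[X in `|X| <= _](subKr v); exact: ler_normB.
  by move=> ?; lra.
have : \forall m \near \oo, forall i : 'I_k, y <= `|v - a m i|.
  exact: filter_forall.
apply: filterS => m my; have [i ik ->] := ua m.
rewrite lee_fin; apply: ge0_ler_powR; rewrite ?nnegrE ?(ltW p_gt0)//.
exact: (my (Ordinal ik)).
Qed.

Lemma measurable_limn_einf (u : (T -> \bar R)^nat) :
  (forall n, measurable_fun setT (u n)) ->
  measurable_fun setT (fun x => limn_einf (u^~ x)).
Proof.
move=> mu_; rewrite /limn_einf.
apply: measurableT_comp; first exact: oppe_measurable.
apply: (measurable_fun_limn_esup (f := fun n x => (- u n x)%E)) => n.
by apply: measurableT_comp => //; exact: oppe_measurable.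
Qed.

Lemma Gpk_proximinal (k : nat) : (0 < k)%N -> proximinal mu p k.
Proof.
move=> k0 f fLp; have mf := fLp.1.
(* On a null space all costs vanish. Elsewhere a positive total mass is what rules out the escape of
   all values. *)
have [T0|T0] := eqVneq (mu setT) 0%E.
  exists (cst 0); apply/(is_minimizerP _ _ p1).
  split=> [|h [[mh _] _]]; first exact: Gpk_cst.
  by rewrite !pcost_null.
pose D := ereal_inf [set pcost mu p setT f h | h in Gpk mu p k].
have Dle h : Gpk mu p k h -> (D <= pcost mu p setT f h)%E.
  by move=> Gh; apply: ereal_inf_lbound; exists h.
have Dfin : D \is a fin_num.
  rewrite ge0_fin_numE; last first.
    by apply: le_ereal_inf_tmp => _ [h _ <-]; exact: pcost_ge0.
  apply: le_lt_trans (pcost0_lty _ _ p1 _ fLp).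
  by apply: Dle; exact: Gpk_cst.
have exh n : exists h, Gpk mu p k h /\
    (pcost mu p setT f h < D + n.+1%:R^-1%:E)%E.
  have n0 : 0 < n.+1%:R^-1 :> R by rewrite invr_gt0 ltr0n.
  have [_ [h Gh <-] hD] := lb_ereal_inf_adherent n0 Dfin.
  by exists h.
have [h hP] := choice exh.
have exa n : exists a : nat -> R, forall x, exists2 i, (i < k)%N & h n x = a i.
  have [[_ [l [a [A [lk pA ->]]]]] _] := hP n.
  exists a => x; have [_ _ /(_ x)[i il Aix]] := pA.
  by exists i; [exact: leq_trans lk|exact: stepfunE Aix].
have [a aP] := choice exa.
have [S [c [phi phiP]]] := cvg_or_escape_subsequence R k a.
pose L x := limn_einf (fun m => (`|f x - h (phi m) x| `^ p)%:E).
have mh n : measurable_fun setT (h n) by have [[[? _] _] _] := hP n.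
have mL : measurable_fun setT L.
  by apply: measurable_limn_einf => n; exact: measurable_pcost.
have LD : (\int[mu]_x L x <= D)%E.
  apply: (@le_trans _ _ (limn_einf (fun m => pcost mu p setT f (h (phi m))))).
    apply: fatou => [//|n|n x _]; first exact: measurable_pcost.
    by rewrite lee_fin powR_ge0.
  (* Since [phi m] is at least [m], the excess over [D] is at most 1/(m+1), eventually below [e]. *)
  apply/lee_addgt0Pr => e e0; apply: limn_einf_le.
  have := near_infty_natSinv_lt (PosNum e0); apply: filterS => m /= me.
  have [_ /ltW hm] := hP (phi m); apply: le_trans hm _.
  rewrite leeD2lE// lee_fin; apply: le_trans (ltW me).
  by rewrite lef_pV2 ?posrE ?ltr0n// ler_nat ltnS; have [] := phiP m.
have L_ge x y : 0 <= y -> (forall i, (i < k)%N -> S i -> y < `|f x - c i|) ->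
    ((y `^ p)%:E <= L x)%E.
  apply: (limn_einf_nearest_ge _ _ _ (fun m => a (phi m)) _ (fun m => h (phi m) x)).
    by move=> m; have [_] := phiP m.
  by move=> m; exact: aP.
(* The finite limits, sorted and without repetition, provide the strictly increasing values that the
   cells require. *)
pose s := sort <=%O (undup [seq c i | i <- iota 0 k & S i]).
pose b := nth 0 s.
have sk : (size s <= k)%N.
  rewrite size_sort (leq_trans (size_undup _))// size_map size_filter.
  by rewrite (leq_trans (count_size _ _))// size_iota.
have b_incr i j : (i < j)%N -> (j < size s)%N -> b i < b j.
  move=> ij js; apply: (sorted_ltn_nth lt_trans) => //.
    by rewrite sort_lt_sorted undup_uniq.
  by rewrite inE (ltn_trans ij).
have c_s i : (i < k)%N -> S i -> c i \in s.
  move=> ik Si; rewrite mem_sort mem_undup; apply/mapP; exists i => //.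
  by rewrite mem_filter Si mem_iota.
(* With no finite limit, [L] would be infinite everywhere, and so would its integral, although it is
   bounded by the finite [D]. *)
have s0 : (0 < size s)%N.
  rewrite lt0n; apply/negP => /nilP s_nil.
  have Ly x : L x = +oo%E.
    apply/eqyP => r r0; have r1 : 1 <= r + 1 by rewrite lerDr ltW.
    apply: (@le_trans _ _ ((r + 1) `^ p)%:E).
      rewrite lee_fin (@le_trans _ _ (r + 1))// ?lerDl//.
      by rewrite -[X in X <= _]powRr1 ?(le_trans _ r1)// ler_powR.
    apply: L_ge; first exact: le_trans r1.
    by move=> i ik /(c_s _ ik); rewrite s_nil.
  have := LD; under eq_integral do rewrite Ly.
  rewrite (integral_cst mu measurableT +oo) gt0_mulye ?lt0e ?T0 ?measure_ge0//.
  by rewrite leye_eq => /eqP Dy; move: Dfin; rewrite Dy.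
have pC := Cset_partition _ _ _ b_incr mf (fun=> s0).
exists (stepfun (size s) b (Cset (size s) b f)); apply/(is_minimizerP _ _ p1).
split=> [|g Gg]; first exact: Gpk_stepfun.
apply: le_trans (Dle _ Gg); apply: le_trans LD.
apply: ge0_le_integral => [//|x _|||x _].
- by rewrite lee_fin powR_ge0.
- by apply: measurable_pcost => //; exact: measurable_stepfun.
- exact: mL.
(* [L_ge] requires a distance strictly below those to the limits; the nearest distance itself is
   reached by left continuity. *)
apply: powR_le_of_lt => //.
  by apply: limn_einf_ge; apply: nearW => m; rewrite lee_fin powR_ge0.
move=> y y0 yg; apply: L_ge => // i ik Si; apply: lt_le_trans yg _.
have [_ _ /(_ x)[j js Cjx]] := pC.
rewrite (stepfunE _ _ _ _ _ pC js Cjx).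
have is_ : (index (c i) s < size s)%N by rewrite index_mem c_s.
have := Cset_nearest _ _ _ b_incr _ _ _ js is_ Cjx.
by rewrite /b (nth_index 0 (c_s _ ik Si)).
Qed.

End proximinal.

(** * Minimizers on the cells of nearest values *)

Theorem theorem2p3 (d : measure_display) (T : measurableType d) (R : realType)
  (mu : {finite_measure set T -> \bar R}) (p : R) (k : nat) :
  1 <= p -> (1 <= k)%N ->
  proximinal mu p k /\
  (forall (f : T -> R) (q : nat) (b : nat -> R) (A : nat -> set T),
    in_Lp mu p f ->
    (q <= k)%N ->
    (forall i j, (i < j)%N -> (j < q)%N -> b i < b j) ->
    meas_partition q A ->
    (forall i, (i < q)%N -> (0 < mu (A i))%E) ->
    is_minimizer mu p k f (stepfun q b A) ->
    [/\ is_minimizer mu p k f (stepfun q b (Cset q b f)),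
        (forall i, (i < q)%N -> (0 < mu (Cset q b f i))%E ->
           is_pmean mu p f (Cset q b f i) (b i)),
        is_minimizer mu p q f
          (stepfun q (fun i => Mp mu p f (Cset q b f i)) (Cset q b f)),
        is_minimizer mu p k f
          (stepfun q (fun i => Mp mu p f (Cset q b f i)) (Cset q b f)) &
        ((forall h, is_minimizer mu p k f h ->
            forall (l : nat) (a : nat -> R),
              (forall x, exists2 i, (i < l)%N & h x = a i) -> (q <= l)%N) ->
         forall i, (i < q)%N -> (0 < mu (Cset q b f i))%E)]).
Proof.
move=> p1 k0; split; first exact: Gpk_proximinal.
move=> f q b A fLp qk b_incr pA muA gmin.
have mf := fLp.1.
have q0 : T -> (0 < q)%N.
  by move=> x; have [_ _ /(_ x)[i iq _]] := pA; exact: leq_ltn_trans iq.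
have pC := Cset_partition _ _ _ b_incr mf q0.
set C := Cset q b f in pC *; have [mC _ covC] := pC.
have Gmono h : Gpk mu p q h -> Gpk mu p k h.
  move=> [hLp [l [a [B [lq pB hE]]]]]; split=> //.
  by exists l, a, B; split=> //; exact: leq_trans qk.
have costC a := pcost_stepfun mu p f q a C mf pC.
have GC a : Gpk mu p q (stepfun q a C) by exact: Gpk_stepfun.
have [_ gmin'] := (is_minimizerP mu p p1 k f _).1 gmin.
have gC_le : (pcost mu p setT f (stepfun q b C) <=
              pcost mu p setT f (stepfun q b A))%E.
  apply: ge0_le_integral => [//|x _|||x _].
  - by rewrite lee_fin powR_ge0.
  - by apply: measurable_pcost => //; exact: measurable_stepfun.
  - by apply: measurable_pcost => //; exact: measurable_stepfun.
  have [i iq Cix] := covC x; have [_ _ /(_ x)[j jq Ajx]] := pA.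
  rewrite (stepfunE _ _ _ _ _ pC iq Cix) (stepfunE _ _ _ _ _ pA jq Ajx).
  rewrite lee_fin; apply: ge0_ler_powR; rewrite ?nnegrE ?(le_trans _ p1)//.
  exact: (Cset_nearest _ _ _ b_incr).
have gC_min h : Gpk mu p k h ->
    (pcost mu p setT f (stepfun q b C) <= pcost mu p setT f h)%E.
  by move=> Gh; apply: le_trans gC_le _; exact: gmin'.
(* Replacing the values block by block, without loss on any block, preserves optimality. *)
have improve a :
    (forall i, (i < q)%N ->
      (pcost mu p (C i) f (cst (a i)) <= pcost mu p (C i) f (cst (b i)))%E) ->
    forall h, Gpk mu p k h ->
      (pcost mu p setT f (stepfun q a C) <= pcost mu p setT f h)%E.
  move=> ab h Gh; apply: le_trans (gC_min h Gh).
  by rewrite (costC a) (costC b); apply: lee_sum => i _; exact: ab.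
have gC_fin : (pcost mu p setT f (stepfun q b C) < +oo)%E.
  exact: le_lt_trans gC_le (minimizer_lty _ _ p1 _ _ _ k0 fLp gmin).
have C_pmean i : (i < q)%N -> is_pmean mu p f (C i) (b i).
  (* Only the value on the block [i] changes; the other blocks contribute a common finite amount,
     which cancels in the comparison. *)
  move=> iq c; pose a j := if j == i then c else b j.
  pose rest := (\sum_(j < q | j != Ordinal iq) pcost mu p (C j) f (cst (b j)))%E.
  have costb : pcost mu p setT f (stepfun q b C) =
      (pcost mu p (C i) f (cst (b i)) + rest)%E.
    by rewrite costC (bigD1 (Ordinal iq)).
  have costa : pcost mu p setT f (stepfun q a C) =
      (pcost mu p (C i) f (cst c) + rest)%E.
    have ai : a i = c by rewrite /a eqxx.
    have aE : (\sum_(j < q | j != Ordinal iq)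
        pcost mu p (C j) f (cst (a j)))%E = rest.
      by apply: eq_bigr => j ji; rewrite [a _]ifN.
    by rewrite -ai -aE costC (bigD1 (Ordinal iq) isT).
  have restfin : rest \is a fin_num.
    have rest0 : (0 <= rest)%E by apply: sume_ge0 => j _; exact: pcost_ge0.
    rewrite (ge0_fin_numE rest0); apply: le_lt_trans gC_fin.
    by rewrite costb; apply: leeDr; exact: pcost_ge0.
  have := gC_min _ (Gmono _ (GC a)).
  by rewrite costa costb leeD2rE.
have null i a a' : (i < q)%N -> mu (C i) = 0%E ->
    pcost mu p (C i) f (cst a) = pcost mu p (C i) f (cst a').
  by move=> iq Ci0; rewrite !pcost_null//; exact: mC.
have gM_min := improve (fun i => Mp mu p f (C i)).
have {}gM_min h : Gpk mu p k h -> (pcost mu p setT f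
    (stepfun q (fun i => Mp mu p f (C i)) C) <= pcost mu p setT f h)%E.
  apply: gM_min => i iq; have [Ci0|Ci0] := eqVneq (mu (C i)) 0%E.
    by rewrite (null i _ (b i) iq Ci0); exact: lexx.
  exact: (is_pmean_Mp mu f (C i) mf (mC i iq) p (b i) p1 Ci0 fLp (C_pmean i iq)).
split.
- by apply/(is_minimizerP _ _ p1); split; [exact: Gmono|exact: gC_min].
- by move=> i iq _; exact: C_pmean.
- apply/(is_minimizerP _ _ p1); split=> [|h Gh]; first exact: GC.
  by apply: gM_min; exact: Gmono.
- by apply/(is_minimizerP _ _ p1); split; [exact: Gmono|exact: gM_min].
(* If the cell [i] were null, its value could be replaced by another [b j] at no cost, leaving a
   minimizer with at most q - 1 values. *)
move=> qmin i iq; rewrite lt0e measure_ge0 andbT; apply/negP => /eqP Ci0.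
have [j jq ji] : exists2 j, (j < q)%N & j != i.
  have [q1|q1] := ltnP 1 q.
    (* The boolean read as a number: 1 if [i] is 0, and 0 otherwise. *)
    exists (i == 0)%N; last by case: (i).
    by case: (i == 0)%N => //=; exact: ltnW.
  have q1' : q = 1%N by apply/eqP; rewrite eqn_leq q1 (leq_ltn_trans _ iq).
  have i0 : i = 0%N by move: iq; rewrite q1' ltnS leqn0 => /eqP.
  (* A single cell is the whole space, which contains the block [A i] of positive measure. *)
  have CT : C i = setT.
    apply/seteqP; split=> // x _; have [m] := covC x.
    by rewrite q1' ltnS leqn0 i0 => /eqP ->.
  have := muA i iq; rewrite ltNge -Ci0 CT le_measure// inE//.
  by have [mA _ _] := pA; exact: mA.
pose a m := if m == i then b j else b m.
have aC_min : is_minimizer mu p k f (stepfun q a C).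
  apply/(is_minimizerP _ _ p1); split; first exact: Gmono.
  apply: improve => m mq; rewrite /a; case: eqP => [->|_]; last exact: lexx.
  by rewrite (null i _ (b i) iq Ci0); exact: lexx.
suff : (q <= q.-1)%N by rewrite leqNgt prednK ?leqnn// (leq_ltn_trans _ iq).
(* [bump i] enumerates the indices other than [i], so q - 1 values suffice. *)
apply: (qmin _ aC_min _ (fun m => b (bump i m))) => x.
have val m : (m < q)%N -> m != i ->
    exists2 n, (n < q.-1)%N & b m = b (bump i n).
  rewrite neq_ltn => mq /orP[mi|im].
    exists m; last by rewrite /bump leqNgt mi.
    by rewrite (leq_trans mi)// -ltnS prednK// (leq_ltn_trans _ iq).
  case: m mq im => [//|m] mq im; exists m; last by rewrite /bump [(i <= m)%N]im.
  by rewrite -ltnS prednK// (ltn_trans _ mq).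
have [m mq Cmx] := covC x; rewrite (stepfunE _ _ _ _ _ pC mq Cmx) /a.
by case: ifPn => [_|mi]; exact: val.
Qed.
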